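(* Let $X$ be a Banach space such that the class $X^{f}$ is $\ast\ast$-closed. If $Y$ is a Banach space with $Y<_fX$ and $F$ is a (closed) subspace of $Y$, then the quotient $Y/F$ is also finitely representable in $X$.
   Context: Finite representability: for Banach spaces $X,Y$, $X<_f Y$ ($X$ is finitely representable in $Y$) means that for every $\varepsilon>0$ and every finite dimensional subspace $A$ of $X$ there are a subspace $B$ of $Y$ and an isomorphism $u:A\to B$ with $\|u\|\,\|u^{-1}\|\le 1+\varepsilon$. $X\sim_f Y$ means $X<_fY$ and $Y<_fX$; the class of finite equivalence of $X$ is $X^{f}=\{Y: X\sim_f Y\}$. Minkowski's base: $\mathfrak{M}$ is the set of all finite dimensional Banach spaces (isometric spaces identified), the disjoint union over $n$ of the sets $\mathfrak{M}_n$ of $n$-dimensional spaces, each with the metric $\log d$, $d$ the Banach–Mazur distance. $H(X)\subseteq\mathfrak{M}$ is the set of finite dimensional subspaces of $X$, and $\mathfrak{M}(X^{f})$ is the closure of $H(X)$ in $\mathfrak{M}$. It depends only on $X^{f}$ and determines $X^{f}$. Operations: for $K\subseteq\mathfrak{M}$, $H(K)$ is the set of all subspaces of members of $K$, $Q(K)$ is the set of all quotients of members of $K$, and $HQ(K)=H(Q(K))$. Let $l_2(X)$ be the $l_2$-sum of countably many copies of $X$ and $\mathsf{D}_2(X^{f})=(l_2(X))^{f}$. The class $\ast\ast(X^{f})$ is the class $W^{f}$ with $\mathfrak{M}(W^{f})=HQ\,\mathfrak{M}(\mathsf{D}_2(X^{f}))$. A class $X^{f}$ is $\ast\ast$-closed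 if $X^{f}=\ast\ast(W^{f})$ for some Banach space $W$. *)

(* Defs.v *)
From HB Require Import structures.
From mathcomp Require Import all_boot all_order all_algebra.
From mathcomp Require Import generic_quotient ring_quotient.
From mathcomp Require Import mathcomp_extra boolp classical_sets functions.
From mathcomp Require Import ring lra.
From mathcomp Require Import reals topology normedtype sequences exp.

Set Implicit Arguments.
Unset Strict Implicit.
Unset Printing Implicit Defensive.

Import Order.TTheory GRing.Theory Num.Theory.
Import numFieldNormedType.Exports.

Local Open Scope classical_set_scope.
Local Open Scope ring_scope.

Section SubspaceNormed.
Variables (R : realType) (V : normedModType R) (A : submodClosed V).

Record subsp := Subsp { subsp_val :> V; subsp_valP : subsp_val \in A }.

HB.instance Definition _ := [isSub for subsp_val].
HB.instance Definition _ := [Choice of subsp by <:].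
HB.instance Definition _ := [SubChoice_isSubLmodule of subsp by <:].

Let subsp_norm (x : subsp) : R := `|subsp_val x|.

Let subsp_normD x y : subsp_norm (x + y) <= subsp_norm x + subsp_norm y.
Proof.
rewrite /subsp_norm; have -> : subsp_val (x + y) = subsp_val x + subsp_val y.
  exact: (raddfD (val : subsp -> V)).
exact: ler_normD.
Qed.

Let subsp_normZ (a : R) x : subsp_norm (a *: x) = `|a| * subsp_norm x.
Proof.
rewrite /subsp_norm; have -> : subsp_val (a *: x) = a *: subsp_val x.
  exact: (linearZ_LR (val : subsp -> V)).
exact: normrZ.
Qed.

Let subsp_norm0_eq0 x : subsp_norm x = 0 -> x = 0.
Proof. by move=> /normr0_eq0 x0; apply: val_inj; rewrite raddf0. Qed.

HB.instance Definition _ :=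
  @Lmodule_isNormed.Build R subsp subsp_norm subsp_normD subsp_normZ
    subsp_norm0_eq0.

End SubspaceNormed.

Section QuotientNormed.
Variables (R : realType) (V : normedModType R) (F : submodClosed V).

Let zmodF : zmod_closed F := GRing.submod_closedB (GRing.submodClosedP F).

Definition submod_zmodClosed : zmodClosed V :=
  HB.pack_for (zmodClosed V) (GRing.SubmodClosed.sort F)
    (GRing.isZmodClosed.Build V (GRing.SubmodClosed.sort F) zmodF).

Definition quotsp of closed [set` F] := Quotient.quot submod_zmodClosed.

Variable cF : closed [set` F].
Local Notation Q := (quotsp cF).

HB.instance Definition _ := GRing.Zmodule.on Q.

Definition quot_pi (x : V) : Q := \pi_(Quotient.quot submod_zmodClosed)%qT x.

Lemma quot_piP x y : quot_pi x = quot_pi y <-> x - y \in F.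
Proof.
have -> : (x - y \in F) = (quot_pi x == quot_pi y).
  exact: (Quotient.idealrBE submod_zmodClosed).
by split => [?|/eqP//]; apply/eqP.
Qed.

Lemma quot_pi_surj (q : Q) : exists x, quot_pi x = q.
Proof. by exists (repr (q : Quotient.quot submod_zmodClosed)); rewrite /quot_pi reprK. Qed.

Fact quot_piD x y : quot_pi (x + y) = quot_pi x + quot_pi y.
Proof. exact: raddfD. Qed.

Definition quot_scale (a : R) (q : Q) : Q :=
  quot_pi (a *: repr (q : Quotient.quot submod_zmodClosed)).

Fact quot_scaleE a x : quot_scale a (quot_pi x) = quot_pi (a *: x).
Proof.
apply/quot_piP; rewrite -scalerBr rpredZ//; apply/quot_piP.
by rewrite /quot_pi reprK.
Qed.

Fact quot_scaleA a b v : quot_scale a (quot_scale b v) = quot_scale (a * b) v.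
Proof. by have [x <-] := quot_pi_surj v; rewrite !quot_scaleE scalerA. Qed.

Fact quot_scale1 : left_id 1 quot_scale.
Proof. by move=> v; have [x <-] := quot_pi_surj v; rewrite quot_scaleE scale1r. Qed.

Fact quot_scaleDr : right_distributive quot_scale +%R.
Proof.
move=> a v w; have [x <-] := quot_pi_surj v; have [y <-] := quot_pi_surj w.
by rewrite -quot_piD !quot_scaleE scalerDr quot_piD.
Qed.

Fact quot_scaleDl v : {morph quot_scale^~ v : a b / a + b}.
Proof.
by move=> a b; have [x <-] := quot_pi_surj v; rewrite !quot_scaleE scalerDl quot_piD.
Qed.

HB.instance Definition _ := GRing.Zmodule_isLmodule.Build R Q
  quot_scaleA quot_scale1 quot_scaleDr quot_scaleDl.

Fact quot_pi_linear : linear quot_pi.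
Proof. by move=> a x y; rewrite quot_piD -quot_scaleE. Qed.

HB.instance Definition _ := GRing.isLinear.Build R V Q *:%R quot_pi quot_pi_linear.

Definition quot_norm (q : Q) : R := inf [set `|x| | x in [set x | quot_pi x = q]].

Let quot_norm_has_inf q :
  has_inf [set `|x| | x in [set x | quot_pi x = q]].
Proof.
split; last by exists 0 => _ [x _ <-].
by have [x xq] := quot_pi_surj q; exists `|x|, x.
Qed.

Lemma quot_norm_le x : quot_norm (quot_pi x) <= `|x|.
Proof. by apply: ge_inf; [exact: (quot_norm_has_inf _).2|exists x]. Qed.

Lemma quot_norm_ge0 q : 0 <= quot_norm q.
Proof.
by apply: lb_le_inf; [exact: (quot_norm_has_inf _).1|move=> _ [x _ <-]].
Qed.

Lemma quot_norm_lt (q : Q) (e : R) :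
  quot_norm q < e -> exists2 x, quot_pi x = q & `|x| < e.
Proof.
by move=> qe; have [_ [x xq <-] xe] := inf_lt (quot_norm_has_inf q).1 qe; exists x.
Qed.

Let quot_normD u v : quot_norm (u + v) <= quot_norm u + quot_norm v.
Proof.
apply/ler_addgt0Pr => e e0.
have e20 : 0 < e / 2 by rewrite divr_gt0.
have [x <- xe] : exists2 x, quot_pi x = u & `|x| < quot_norm u + e / 2.
  by apply: quot_norm_lt; rewrite ltrDl.
have [y <- ye] : exists2 y, quot_pi y = v & `|y| < quot_norm v + e / 2.
  by apply: quot_norm_lt; rewrite ltrDl.
rewrite -quot_piD [e]splitr addrACA.
apply: (le_trans (quot_norm_le _)); apply: (le_trans (ler_normD _ _)).
by rewrite lerD// ltW.
Qed.

Let quot_normZ_le (a : R) v : quot_norm (a *: v) <= `|a| * quot_norm v.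
Proof.
have [->|a0] := eqVneq a 0.
  rewrite scale0r normr0 mul0r -[0 in leLHS](linear0 quot_pi).
  by rewrite (le_trans (quot_norm_le _))// normr0.
rewrite -ler_pdivrMl ?normr_gt0//.
apply: lb_le_inf => [|_ [x <- <-]]; first exact: (quot_norm_has_inf _).1.
by rewrite ler_pdivrMl ?normr_gt0// -normrZ -linearZ quot_norm_le.
Qed.

Let quot_normZ (a : R) v : quot_norm (a *: v) = `|a| * quot_norm v.
Proof.
apply/eqP; rewrite eq_le quot_normZ_le/=.
have [->|a0] := eqVneq a 0; first by rewrite normr0 mul0r quot_norm_ge0.
rewrite -ler_pdivlMl ?normr_gt0// -normfV.
by rewrite -[v in leLHS](scalerK a0) quot_normZ_le.
Qed.

Let quot_norm0_eq0 v : quot_norm v = 0 -> v = 0.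
Proof.
have [x <-] := quot_pi_surj v => x0.
rewrite -(linear0 quot_pi); apply/quot_piP; rewrite subr0.
suff : closure [set` F] x by move/cF.
move=> B /nbhs_ballP[e /= e0 Be].
have [y yx ye] : exists2 y, quot_pi y = quot_pi x & `|y| < e.
  by apply: quot_norm_lt; rewrite x0.
exists (x - y); split; first by apply/quot_piP.
by apply: Be; rewrite -ball_normE /ball_/= opprB addrC subrK.
Qed.

HB.instance Definition _ :=
  @Lmodule_isNormed.Build R Q quot_norm quot_normD quot_normZ quot_norm0_eq0.

End QuotientNormed.

Section QuotientComplete.
Variables (R : realType) (V : completeNormedModType R) (F : submodClosed V).
Variable cF : closed [set` F].
Local Notation Q := (quotsp cF).

Let quot_normE (q : Q) : `|q| = quot_norm q. Proof. by []. Qed.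

Let quot_complete (G : set_system Q) : ProperFilter G -> cauchy G -> cvg G.
Proof.
move=> FG /cauchyP GC.
have half1 : `|2^-1 : R| < 1.
  by rewrite ger0_norm ?invr_ge0// invf_lt1// ltr1n.
have e_gt0 n : 0 < (2^-1 ^+ n : R).
  by apply: exprn_gt0; rewrite invr_gt0.
have /choice[z zG] : forall n, exists z : Q, G (ball z (2^-1 ^+ n : R)).
  by move=> n; exact: GC (e_gt0 n).
have zS n : `|z n.+1 - z n| < 2 * 2^-1 ^+ n.
  have [w [/= w1 w2]] := filter_ex (filterI (zG n.+1) (zG n)).
  move: w1 w2; rewrite -!ball_normE /ball_/= => w1 w2.
  rewrite -(subrKA w) (le_lt_trans (ler_normD _ _))//.
  rewrite mulr_natl mulr2n ltrD//; last by rewrite distrC.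
  by rewrite (lt_le_trans w1)// exprS ler_piMl// ?ltW// invf_lt1// ltr1n.
have /choice[d dP] : forall n, exists d : V, quot_pi cF d = z n.+1 - z n /\
    `|d| < 2 * 2^-1 ^+ n.
  by move=> n; have [d ? ?] := quot_norm_lt (zS n); exists d.
have [y0 y0z] := quot_pi_surj (z 0).
have sd n : quot_pi cF (y0 + series d n) = z n.
  elim: n => [|n IH]; first by rewrite /series/= big_geq// addr0.
  rewrite seriesSr addrA quot_piD IH (dP n).1.
  by rewrite addrC subrK.
have cd : cvgn (series d).
  apply: normed_cvg.
  apply: (@series_le_cvg _ _ (geometric 2 2^-1)) => [n|n|n|].
  - exact: normr_ge0.
  - by rewrite /geometric/= mulr_ge0// ltW.
  - by rewrite ltW// (dP n).2.
  - exact: is_cvg_geometric_series.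
apply/cvg_ex; exists (quot_pi cF (y0 + limn (series d))).
apply/cvgrPdist_lt => e e0.
have e20 : 0 < e / 2 by rewrite divr_gt0.
have : (2^-1 ^+ n : R) @[n --> \oo] --> 0.
  exact: cvg_expr.
move=> /cvgrPdist_lt/(_ _ e20)[N1 _ N1P].
have /cvgrPdist_lt/(_ _ e20)[N2 _ N2P] := cd.
pose n := maxn N1 N2.
have := zG n; apply: filterS => w; rewrite -ball_normE /ball_/= => zw.
rewrite -(subrKA (z n)) (le_lt_trans (ler_normD _ _))// [e]splitr ltrD//.
  rewrite -sd -linearB/= opprD addrACA subrr add0r quot_normE.
  rewrite (le_lt_trans (quot_norm_le _ _))//.
  by apply: N2P => /=; rewrite leq_maxr.
rewrite (lt_le_trans zw)// ltW//.
have /= := N1P n; rewrite leq_maxl => /(_ isT).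
by rewrite sub0r normrN ger0_norm// ltW.
Qed.

HB.instance Definition _ := Uniform_isComplete.Build Q quot_complete.

End QuotientComplete.

Section L2Sum.
Variables (R : realType) (V : normedModType R).
Implicit Types x y : nat -> V.

Definition sq_series x : R ^nat := series (fun n => `|x n| ^+ 2).

Definition l2_mem : {pred nat -> V} := [pred x | `[< cvgn (sq_series x) >]].

Lemma sq_series_nd x : nondecreasing_seq (sq_series x).
Proof. by apply: nondecreasing_series => n _ _; exact: sqr_ge0. Qed.

Lemma l2_memP x : reflect (cvgn (sq_series x)) (x \in l2_mem).
Proof. by rewrite inE; exact: asboolP. Qed.

Lemma l2_mem_bound x (M : R) : (forall n, sq_series x n <= M) -> x \in l2_mem.
Proof.
move=> xM; apply/l2_memP; apply: nondecreasing_is_cvgn.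
  exact: sq_series_nd.
by exists M => _ [n _ <-].
Qed.

Lemma sq_series_le x n : x \in l2_mem -> sq_series x n <= limn (sq_series x).
Proof. by move=> /l2_memP cx; apply: nondecreasing_cvgn_le; first exact: sq_series_nd. Qed.

Lemma lim_sq_series_le x (M : R) :
  (forall n, sq_series x n <= M) -> limn (sq_series x) <= M.
Proof.
by move=> xM; apply: limr_le; [exact/l2_memP/(l2_mem_bound xM)|exact: nearW].
Qed.

Lemma sq_series_ge0 x n : 0 <= sq_series x n.
Proof. by apply: sumr_ge0 => i _; exact: sqr_ge0. Qed.

Lemma sq_seriesS x n : sq_series x n.+1 = sq_series x n + `|x n| ^+ 2.
Proof. by rewrite /sq_series seriesSr. Qed.

Lemma sq_seriesZ (a : R) x n :
  sq_series (a *: x) n = `|a| ^+ 2 * sq_series x n.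
Proof.
rewrite /sq_series /series/= mulr_sumr; apply: eq_bigr => i _.
by rewrite /GRing.scale/= normrZ exprMn.
Qed.

Lemma sq_series0 n : sq_series 0 n = 0.
Proof. by rewrite /sq_series /series/= big1// => i _; rewrite normr0 expr0n. Qed.

(* Minkowski's inequality in l_2^n *)
Lemma sq_seriesD x y n (a b : R) : 0 <= a -> 0 <= b ->
  sq_series x n <= a ^+ 2 -> sq_series y n <= b ^+ 2 ->
  sq_series (x + y) n <= (a + b) ^+ 2.
Proof.
elim: n a b => [|n IH] a b a0 b0.
  by rewrite /sq_series /series/= !big_geq// => _ _; exact: sqr_ge0.
rewrite !sq_seriesS => xa yb.
set p := Num.sqrt (sq_series x n); set q := Num.sqrt (sq_series y n).
have p0 : 0 <= p by exact: sqrtr_ge0.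
have q0 : 0 <= q by exact: sqrtr_ge0.
have p2 : p ^+ 2 = sq_series x n by rewrite sqr_sqrtr// sq_series_ge0.
have q2 : q ^+ 2 = sq_series y n by rewrite sqr_sqrtr// sq_series_ge0.
have {}IH : sq_series (x + y) n <= (p + q) ^+ 2.
  by apply: IH => //; rewrite ?p2 ?q2.
have tri : `|(x + y) n| ^+ 2 <= (`|x n| + `|y n|) ^+ 2.
  by rewrite ler_sqr ?nnegrE ?addr_ge0 ?normr_ge0// ler_normD.
apply: (le_trans (lerD IH tri)).
move: xa yb; rewrite -p2 -q2 => xa yb.
have s0 : 0 <= `|x n| by []. have t0 : 0 <= `|y n| by [].
move: s0 t0 xa yb; set s := `|x n|; set t := `|y n| => s0 t0 xa yb.
have cs : p * q + s * t <= a * b.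
  rewrite -ler_sqr ?nnegrE ?addr_ge0 ?mulr_ge0//.
  apply: (@le_trans _ _ ((p ^+ 2 + s ^+ 2) * (q ^+ 2 + t ^+ 2))).
    have := sqr_ge0 (p * t - s * q); nra.
  by rewrite exprMn ler_pM ?addr_ge0 ?sqr_ge0.
nra.
Qed.

Let l2_sqrt x : x \in l2_mem ->
  forall n, sq_series x n <= Num.sqrt (limn (sq_series x)) ^+ 2.
Proof.
move=> x2 n; rewrite sqr_sqrtr ?sq_series_le//.
exact: le_trans (sq_series_ge0 x n) (sq_series_le n x2).
Qed.

Fact l2_mem_submod : submod_closed l2_mem.
Proof.
split=> [|a x y x2 y2].
  by apply: (@l2_mem_bound _ 0) => n; rewrite sq_series0.
have xM n : sq_series (a *: x) n <= (`|a| * Num.sqrt (limn (sq_series x))) ^+ 2.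
  by rewrite sq_seriesZ exprMn ler_wpM2l ?sqr_ge0// l2_sqrt.
apply: l2_mem_bound => n; apply: sq_seriesD (xM n) (l2_sqrt y2 n).
  by rewrite mulr_ge0 ?sqrtr_ge0.
exact: sqrtr_ge0.
Qed.

Record l2sum := L2sum { l2_val :> nat -> V; l2_valP : l2_val \in l2_mem }.

HB.instance Definition _ := [isSub for l2_val].
HB.instance Definition _ := [Choice of l2sum by <:].
HB.instance Definition _ :=
  GRing.SubChoice_isSubLmodule.Build R (nat -> V) l2_mem l2sum l2_mem_submod.

Definition l2_norm (x : l2sum) : R := Num.sqrt (limn (sq_series x)).

Lemma l2_valD (x y : l2sum) : l2_val (x + y) = l2_val x + l2_val y.
Proof. exact: (raddfD (val : l2sum -> (nat -> V))). Qed.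

Lemma l2_valB (x y : l2sum) : l2_val (x - y) = l2_val x - l2_val y.
Proof. exact: (raddfB (val : l2sum -> (nat -> V))). Qed.

Lemma l2_valZ (a : R) (x : l2sum) : l2_val (a *: x) = a *: l2_val x.
Proof. exact: (linearZ_LR (val : l2sum -> (nat -> V))). Qed.

Lemma l2_norm_leP (x : l2sum) (M : R) : 0 <= M ->
  l2_norm x <= M <-> forall n, sq_series x n <= M ^+ 2.
Proof.
move=> M0; split=> [xM n|xM].
  apply: (le_trans (l2_sqrt (l2_valP x) n)).
  by rewrite ler_sqr ?nnegrE ?sqrtr_ge0.
by rewrite -[M]ger0_norm// -sqrtr_sqr ler_wsqrtr// lim_sq_series_le.
Qed.

Let l2_normD (x y : l2sum) : l2_norm (x + y) <= l2_norm x + l2_norm y.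
Proof.
apply/l2_norm_leP; first by rewrite addr_ge0 ?sqrtr_ge0.
move=> n; rewrite l2_valD; apply: sq_seriesD; rewrite ?sqrtr_ge0 ?l2_sqrt ?l2_valP//.
Qed.

Let l2_normZ (a : R) (x : l2sum) : l2_norm (a *: x) = `|a| * l2_norm x.
Proof.
rewrite /l2_norm l2_valZ.
rewrite (_ : sq_series _ = (fun n => `|a| ^+ 2 * sq_series x n)); last first.
  by apply/funext => n; rewrite sq_seriesZ.
have /l2_memP cx := l2_valP x.
have -> : limn (fun n => `|a| ^+ 2 * sq_series x n) = `|a| ^+ 2 * limn (sq_series x).
  by apply: cvg_lim => //; apply: cvgM cx; exact: cvg_cst.
by rewrite sqrtrM ?sqr_ge0// sqrtr_sqr normr_id.
Qed.

Lemma le_l2_norm (x : l2sum) n : `|x n| <= l2_norm x.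
Proof.
rewrite -ler_sqr ?nnegrE ?sqrtr_ge0//.
apply: le_trans (l2_sqrt (l2_valP x) n.+1).
by rewrite sq_seriesS lerDr sq_series_ge0.
Qed.

Let l2_norm0_eq0 (x : l2sum) : l2_norm x = 0 -> x = 0.
Proof.
move=> x0; apply: val_inj; rewrite raddf0; apply/funext => n.
by apply: normr0_eq0; apply/eqP; rewrite -normr_le0 normr_id -x0 le_l2_norm.
Qed.

HB.instance Definition _ :=
  @Lmodule_isNormed.Build R l2sum l2_norm l2_normD l2_normZ l2_norm0_eq0.

End L2Sum.

Section L2SumComplete.
Variables (R : realType) (V : completeNormedModType R).
Local Notation L := (l2sum V).

Let l2_normE (x : L) : `|x| = l2_norm x. Proof. by []. Qed.

Let l2_complete (G : set_system L) : ProperFilter G -> cauchy G -> cvg G.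
Proof.
move=> FG /cauchyP GC.
have /choice[y yG] : forall n, exists y : V, (x : L) n @[x --> G] --> y.
  move=> n; apply/cvg_ex; apply: cauchy_cvg; apply: cauchy_exP => e e0.
  have [z zG] := GC e e0; exists ((z : L) n).
  suff : G [set x : L | ball ((z : L) n) e (x n)] by [].
  apply: filterS zG => x; rewrite -!ball_normE /ball_/=.
  by apply: le_lt_trans; have := le_l2_norm ((z : L) - x) n; rewrite l2_valB.
have key e : 0 < e ->
    exists2 z : L, (G (ball z e)) & forall n, sq_series (l2_val z - y) n <= e ^+ 2.
  move=> e0; have [z zG] := GC e e0; exists z => // n.
  have : (sq_series (l2_val z - l2_val x) n) @[x --> G] --> sq_series (l2_val z - y) n.
    elim: n => [|n IH].
      rewrite /sq_series /series/= big_geq//.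
      by under eq_fun do rewrite big_geq//; exact: cvg_cst.
    rewrite sq_seriesS; under eq_fun do rewrite sq_seriesS.
    apply: cvgD IH _; rewrite expr2; under eq_fun do rewrite expr2.
    by apply: cvgM; apply: cvg_norm; apply: cvgB => //; exact: cvg_cst.
  move=> zc; apply: cvgr_to_le zc _.
  apply: filterS zG => x; rewrite -ball_normE /ball_/= l2_normE => /ltW.
  by move=> /(l2_norm_leP _ (ltW e0))/(_ n); rewrite l2_valB.
have y2 : y \in @l2_mem R V.
  have [z _ zy] := key 1 ltr01.
  have zy2 := l2_mem_bound zy.
  have := (l2_valP (z - L2sum zy2)); rewrite l2_valB/=.
  by rewrite opprB addrC subrK.
apply/cvg_ex; exists (L2sum y2); apply/cvgrPdist_le => e e0.
have e20 : 0 < e / 2 by rewrite divr_gt0.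
have [z zG zy] := key _ e20.
apply: filterS zG => x; rewrite -ball_normE /ball_/= => zx.
rewrite -(subrKA z) (le_trans (ler_normD _ _))// [e]splitr lerD//; last exact: ltW.
rewrite distrC l2_normE; apply/(l2_norm_leP _ (ltW e20)) => n.
by rewrite l2_valB.
Qed.

HB.instance Definition _ := Uniform_isComplete.Build L l2_complete.

End L2SumComplete.

Section Isomorphisms.
Variable R : realType.

Definition has_dim (V : lmodType R) (n : nat) : Prop :=
  exists f : {linear V -> 'rV[R]_n}, bijective f.

Definition finite_dim (V : lmodType R) : Prop := exists n, has_dim V n.

Record isomorphism (V W : normedModType R) := Isomorphism {
  iso_fwd : {linear V -> W};
  iso_bwd : {linear W -> V};
  iso_fwdK : cancel iso_fwd iso_bwd;
  iso_bwdK : cancel iso_bwd iso_fwd;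
  iso_fwd_continuous : continuous iso_fwd;
  iso_bwd_continuous : continuous iso_bwd }.

(* [sup] is the actual supremum only for bounded sets; [opnorm] is only used
   on continuous maps *)
Definition opnorm (V W : normedModType R) (u : {linear V -> W}) : R :=
  sup [set `|u x| | x in [set x : V | `|x| <= 1]].

Definition distortion (V W : normedModType R) (u : isomorphism V W) : R :=
  opnorm (iso_fwd u) * opnorm (iso_bwd u).

Definition isometric (V W : normedModType R) : Prop :=
  exists f : {linear V -> W}, bijective f /\ forall x, `|f x| = `|x|.

Definition bmdist (V W : normedModType R) : R :=
  inf [set d | exists u : isomorphism V W, d = distortion u].

Definition fin_rep (X Y : completeNormedModType R) : Prop :=
  forall e : R, 0 < e ->
  forall A : submodClosed X, finite_dim (subsp A) ->
  exists (B : submodClosed Y) (u : isomorphism (subsp A) (subsp B)),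
    distortion u <= 1 + e.

Definition fin_equiv (X Y : completeNormedModType R) : Prop :=
  fin_rep X Y /\ fin_rep Y X.

Definition fin_class (X : completeNormedModType R) :
  completeNormedModType R -> Prop := fun Y => fin_equiv X Y.

End Isomorphisms.

Section MinkowskiBase.
Variable R : realType.

(* Isometric spaces are not identified by a quotient: a subset of Minkowski's
   base is represented by the set of all spaces whose isometry type it
   contains, and every operation below produces isometry-invariant sets. *)
Record minkowski := Minkowski {
  mk_space :> completeNormedModType R;
  mk_dim : nat;
  mk_dimP : has_dim mk_space mk_dim }.

(* Not [set], whose universe is too small for a type of normed spaces *)
Definition mk_set := minkowski -> Prop.

Implicit Types (E G : minkowski) (K : mk_set).

(* [ln (bmdist E G)] is the metric of the component of spaces of dimension
   [mk_dim E]; in dimension 0, [bmdist] is 0 and [ln 0 = 0] *)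
Definition mk_ball E (e : R) : mk_set :=
  fun G => mk_dim G = mk_dim E /\ ln (bmdist E G) < e.

Definition mk_closure K : mk_set :=
  fun E => forall e : R, 0 < e -> exists G, K G /\ mk_ball E e G.

Definition subspaces_of (V : normedModType R) : mk_set :=
  fun E => exists A : submodClosed V, isometric E (subsp A).

Definition quotients_of (V : normedModType R) : mk_set :=
  fun E => exists (F : submodClosed V) (cF : closed [set` F]),
    isometric E (quotsp cF).

Definition mk_H K : mk_set := fun E => exists G, K G /\ subspaces_of G E.

Definition mk_Q K : mk_set := fun E => exists G, K G /\ quotients_of G E.

Definition mk_HQ K : mk_set := mk_H (mk_Q K).

Definition mk_base (X : completeNormedModType R) : mk_set :=
  mk_closure (subspaces_of X).

End MinkowskiBase.

Section StarStar.
Variable R : realType.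
Implicit Types (W X V : completeNormedModType R).

(* [is_starstar W C] states that C = **(W^f), the class of a Banach space V
   such that M(V^f) = HQ M(D_2(W^f)), where D_2(W^f) is the class of l_2(W) *)
Definition is_starstar W (C : completeNormedModType R -> Prop) : Prop :=
  exists V, C = fin_class V /\ mk_base V = mk_HQ (mk_base (l2sum W)).

Definition starstar_closed (C : completeNormedModType R -> Prop) : Prop :=
  exists W, is_starstar W C.

End StarStar.

(* Main.v *)
(* A finite-dimensional subspace A of Y/F is, up to 1 + eps, a quotient G/N of
   a finite-dimensional G < Y: choose G containing almost norm-minimal lifts of
   a finite net of the unit sphere of A, and N = G \cap F. As Y <_f X, G lies in
   M(X^f), which has the form HQ(K). A quotient of a subspace of Z is a subspace
   of a quotient of Z, so HQ(K) is stable under quotients. Hence G/N lies in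
   M(X^f) as well, that is, G/N embeds almost isometrically into X. *)

Require Import Defs.
From HB Require Import structures.
From mathcomp Require Import all_boot all_order all_algebra.
From mathcomp Require Import boolp classical_sets.
From mathcomp Require Import finmap lra.
From mathcomp Require Import reals topology normedtype sequences exp derive.

Set Implicit Arguments.
Unset Strict Implicit.
Unset Printing Implicit Defensive.

Import Order.TTheory GRing.Theory Num.Theory.
Import numFieldNormedType.Exports.
Local Open Scope classical_set_scope.
Local Open Scope ring_scope.

(** * Subspaces from predicates, linear maps from relations *)

Lemma inj_surj_bijective (T U : Type) (f : T -> U) :
  injective f -> (forall y, exists x, f x = y) -> bijective f.
Proof.
move=> finj /choice[g gK]; exists g => // x.
by apply: finj; rewrite gK.
Qed.

Section LinearRelations.
Variable R : realType.
Implicit Types V W : lmodType R.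

Lemma submod_of V (P : V -> Prop) : P 0 ->
  (forall a x y, P x -> P y -> P (a *: x + y)) ->
  exists A : submodClosed V, forall x, x \in A <-> P x.
Proof.
move=> P0 PD; pose S : {pred V} := fun x => `[< P x >].
have SP : submod_closed S.
  split=> [|a x y]; rewrite -!topredE; first exact/asboolP.
  by move=> /asboolP xP /asboolP yP; apply/asboolP/PD.
exists (HB.pack_for (submodClosed V) S (GRing.isSubmodClosed.Build R V S SP)).
by move=> x; split=> [/asboolP|Px]; last exact/asboolP.
Qed.

(** Two values at one point differ by a value at 0, so the last hypothesis makes [r] single-valued,
    and any choice function for [r] is then linear. Maps on ranges and quotients are built this way,
    from relations between representatives. *)
Lemma rel_linear V W (r : V -> W -> Prop) :
  (forall x, exists y, r x y) ->
  (forall a x x' y y', r x y -> r x' y' -> r (a *: x + x') (a *: y + y')) ->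
  (forall y, r 0 y -> y = 0) ->
  exists f : {linear V -> W}, forall x, r x (f x).
Proof.
move=> /choice[f rf] rD r0.
have fun_r x y y' : r x y -> r x y' -> y = y'.
  move=> rxy rxy'; apply/eqP; rewrite -subr_eq0; apply/eqP/r0.
  have := rD (-1) _ _ _ _ rxy' rxy.
  by rewrite !scaleN1r addNr addrC.
have fl : linear f by move=> a x y; apply: fun_r (rf _) (rD _ _ _ _ _ _ _).
by exists (HB.pack_for {linear V -> W} f (GRing.isLinear.Build R V W *:%R f fl)).
Qed.

Lemma bijective_linear_inv V W (f : {linear V -> W}) : bijective f ->
  exists g : {linear W -> V}, cancel f g /\ cancel g f.
Proof.
move=> [g fK gK].
have [|a x x' y y' <- <-|y|h hP] := @rel_linear W V (fun y x => f x = y).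
- by move=> y; exists (g y).
- by rewrite linearP.
- by rewrite -(linear0 f); apply: (can_inj fK).
by exists h; split=> // x; apply: (can_inj fK).
Qed.

End LinearRelations.

(** * Finite dimension in coordinates *)

Section FiniteDimension.
Variable R : realType.
Implicit Types V W : lmodType R.

(** Take [A] of maximal rank among the matrices whose row space lies in [P]. Adjoining a vector of
    [P] to [A] cannot raise the rank, so the vector is already in the row space. *)
Lemma submod_rowspace n (P : 'rV[R]_n -> Prop) : P 0 ->
  (forall a x y, P x -> P y -> P (a *: x + y)) ->
  exists A : 'M[R]_n, forall v : 'rV_n, P v <-> (v <= A)%MS.
Proof.
move=> P0 PD.
pose Q r := `[< exists2 A : 'M[R]_n, \rank A = r &
                  forall v : 'rV_n, (v <= A)%MS -> P v >].
have Qex : exists r, Q r.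
  exists 0%N; apply/asboolP; exists 0; first by rewrite mxrank0.
  by move=> v; rewrite submx0 => /eqP->.
have Qn r : Q r -> (r <= n)%N by move=> /asboolP[A <- _]; exact: rank_leq_row.
case: (ex_maxnP Qex Qn) => r /asboolP[A Ar AP] rmax.
exists A => v; split=> [Pv|/AP//].
have /rmax : Q (\rank (A + v)%MS).
  apply/asboolP; exists (A + v)%MS => // u /sub_addsmxP[[u1 u2] ->]/=.
  rewrite addrC; have -> : u2 *m v = u2 0 0 *: v.
    by rewrite -mul_scalar_mx; congr (_ *m _); exact: mx11_scalar.
  by apply: PD => //; apply: AP; exact: submxMl.
rewrite -Ar (geq_leqif (mxrank_leqif_sup (addsmxSl A v))).
exact: submx_trans (addsmxSr A v).
Qed.

Lemma has_dimP V n : has_dim V n -> exists (f : {linear V -> 'rV[R]_n})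
  (g : {linear 'rV[R]_n -> V}), cancel f g /\ cancel g f.
Proof. by move=> [f /bijective_linear_inv[g fgK]]; exists f, g. Qed.

Lemma has_dim_bij V W n (h : {linear V -> W}) :
  bijective h -> has_dim V n -> has_dim W n.
Proof.
move=> /bijective_linear_inv[k [hK kK]] [f fb].
exists (f \o k : {linear _ -> _}) => /=.
by apply: bij_comp => //; exists h.
Qed.

(** In coordinates the kernel of [h] is the row space of some [A]. The rows of [B] form a basis of a
    complement, which [k] maps bijectively onto [W]. *)
Lemma finite_dim_surj V W (h : {linear V -> W}) :
  (forall y, exists x, h x = y) -> finite_dim V -> finite_dim W.
Proof.
move=> hs [n /has_dimP[f [g [fK gK]]]].
pose k := h \o g : {linear 'rV[R]_n -> W}.
have [|a x y kx ky|A AP] := @submod_rowspace n (fun v => k v = 0).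
- by rewrite linear0.
- by rewrite linearP kx ky scaler0 addr0.
pose B := row_base A^C%MS.
have kB c : k (c *m B) = 0 -> c = 0 :> 'rV_(\rank A^C%MS).
  move=> /AP cA.
  have : (c *m B <= A :&: A^C)%MS.
    by rewrite sub_capmx cA -(eq_row_base A^C%MS) submxMl.
  rewrite capmx_compl submx0 => /eqP c0.
  by apply: (row_free_inj (row_base_free A^C%MS)); rewrite c0 mul0mx.
pose e := k \o mulmxr B : {linear 'rV[R]_(\rank A^C%MS) -> W}.
have eb : bijective e.
  apply: inj_surj_bijective => [x y exy|y].
    apply/eqP; rewrite -subr_eq0; apply/eqP/kB.
    by rewrite mulmxBl linearB; apply/eqP; rewrite subr_eq0; exact/eqP.
  have [x hx] := hs y.
  have : (f x <= A + A^C)%MS by rewrite submx_full// addsmx_compl_full.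
  move=> /sub_addsmxP[[u1 u2]] /= fx.
  have : (u2 *m A^C%MS <= A^C)%MS by exact: submxMl.
  rewrite -(eq_row_base A^C%MS) => /submxP[c cu]; exists c.
  rewrite /e/= -cu -hx -(fK x) fx linearD linearD.
  suff -> : h (g (u1 *m A)) = 0 by rewrite add0r.
  by apply/AP; exact: submxMl.
by have [e' [eK e'K]] := bijective_linear_inv eb; exists (\rank A^C%MS), e', e.
Qed.

End FiniteDimension.

(** * Boundedness of linear maps and completeness in finite dimension *)

Section NormEquivalence.
Variable R : realType.
Implicit Types V W : normedModType R.

(** Row vectors carry the maximum norm, so the norms of the images of the unit vectors add up to a
    bound; the extra 1 keeps the constant positive. *)
Lemma rV_linear_bounded n V (g : {linear 'rV[R]_n -> V}) :
  exists2 C, 0 < C & forall v, `|g v| <= C * `|v|.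
Proof.
exists (1 + \sum_i `|g (delta_mx 0 i)|).
  by rewrite ltr_pwDl// sumr_ge0.
move=> v; rewrite [in leLHS](row_sum_delta v) linear_sum.
rewrite (le_trans (ler_norm_sum _ _ _))// mulrDl mul1r ler_wpDl// mulr_suml.
apply: ler_sum => i _; rewrite linearZ normrZ mulrC ler_wpM2l//.
by rewrite [leRHS]/Num.norm/= mx_normrE; apply/bigmax_geP; right; exists (0, i).
Qed.

Lemma bounded_continuous V W (h : {linear V -> W}) (C : R) :
  (forall x, `|h x| <= C * `|x|) -> continuous h.
Proof.
move=> hC; apply: bounded_linear_continuous; apply/linear_boundedP.
exists C; split; first exact: num_real.
by move=> r Cr x; rewrite (le_trans (hC x))// ler_wpM2r// ltW.
Qed.

(** On the compact unit sphere [|g v|] attains its minimum, which is positive by injectivity; [C] is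
    its inverse. *)
Lemma rV_linear_bounded_below n V (g : {linear 'rV[R]_n -> V}) : injective g ->
  exists2 C, 0 < C & forall v, `|v| <= C * `|g v|.
Proof.
move=> gi; have [C C0 gC] := rV_linear_bounded g.
pose S : set 'rV[R]_n := [set v | `|v| = 1].
have gN : continuous (fun v => `|g v|).
  have gc : continuous g by exact: bounded_continuous gC.
  by move=> v; exact: cvg_norm (gc v).
(* An empty sphere means that 0 is the only vector, and any constant works. *)
have [S0|/set0P S0] := eqVneq S set0.
  exists 1 => // v; have [->|v0] := eqVneq v 0; first by rewrite normr0 mulr_ge0.
  have : S (`|v|^-1 *: v).
    by rewrite /S/= normrZ normfV normr_id mulVf// normr_eq0.
  by rewrite S0.
have Sc : compact S.
  apply: bounded_closed_compact.
    by exists 1; split=> // M M1 v; rewrite /S/= => ->; exact: ltW.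
  have -> : S = (fun v => `|v|) @^-1` [set 1] by [].
  by apply: closed_comp => [v _|]; [exact: norm_continuous|exact: closed_eq].
have [c Sc1 cmin] := compact_EVT_min S0 Sc (continuous_subspaceT gN).
move: Sc1 => /set_mem/= c1.
have gc0 : 0 < `|g c|.
  rewrite normr_gt0; apply/eqP => gc; have := oner_neq0 R.
  by rewrite -c1 (gi c 0) ?normr0 ?eqxx// gc linear0.
exists `|g c|^-1; first by rewrite invr_gt0.
move=> v; have [->|v0] := eqVneq v 0.
  by rewrite normr0 mulr_ge0// invr_ge0.
have vS : `|v|^-1 *: v \in S.
  by apply: mem_set; rewrite /S/= normrZ normfV normr_id mulVf// normr_eq0.
rewrite ler_pdivlMl//; have := cmin _ vS.
by rewrite linearZ normrZ normfV normr_id ler_pdivlMl ?normr_gt0// mulrC.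
Qed.

Lemma finite_dim_linear_bounded V W (h : {linear V -> W}) : finite_dim V ->
  exists2 C, 0 < C & forall x, `|h x| <= C * `|x|.
Proof.
move=> [n /has_dimP[f [g [fK gK]]]].
have [C C0 CP] := rV_linear_bounded (h \o g : {linear _ -> _}).
have [D D0 DP] := rV_linear_bounded_below (can_inj gK).
exists (C * D); first exact: mulr_gt0.
move=> x; rewrite -{1}(fK x) (le_trans (CP _))// -mulrA ler_pM2l//.
by rewrite (le_trans (DP _))// fK.
Qed.

Lemma continuous_bounded V W (h : {linear V -> W}) : continuous h ->
  exists2 C, 0 < C & forall x, `|h x| <= C * `|x|.
Proof.
move=> /(_ 0) /continuous_linear_bounded/linear_boundedP/pinfty_ex_gt0[C C0 hC].
by exists C.
Qed.

(** Coordinates are bounded in both directions, so Cauchy filters and their limits can be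
    transported. This lets any finite dimensional normed space serve as a point of Minkowski's base,
    whose points are complete by definition. *)
Lemma finite_dim_complete V : finite_dim V ->
  forall G : set_system V, ProperFilter G -> cauchy G -> cvg G.
Proof.
move=> Vf G FG /cauchyP GC; have [n /has_dimP[f [g [fK gK]]]] := Vf.
have [C C0 fC] := finite_dim_linear_bounded f Vf.
have [D D0 gD] := rV_linear_bounded g.
have /cvg_ex[l fl] : cvg (f x @[x --> G]).
  apply: cauchy_cvg; apply: cauchy_exP => e e0.
  have [x xG] := GC _ (divr_gt0 e0 C0); exists (f x).
  suff : G [set y | ball (f x) e (f y)] by [].
  apply: filterS xG => y; rewrite -!ball_normE /ball_/= ltr_pdivlMr// mulrC.
  by apply: le_lt_trans; rewrite -linearB.
apply/cvg_ex; exists (g l).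
have gc : continuous g by exact: bounded_continuous gD.
have := cvg_comp f g fl (gc l).
by have -> : g \o (fun x => f x) = id by apply/funext => x; exact: fK.
Qed.

End NormEquivalence.

(** * Operator norm and distortion *)

Section OperatorNorm.
Variable R : realType.
Implicit Types V W : normedModType R.

Lemma opnorm_le V W (u : {linear V -> W}) (C : R) : 0 <= C ->
  (forall x, `|u x| <= C * `|x|) -> opnorm u <= C.
Proof.
move=> C0 uC; apply: ge_sup; first by exists `|u 0|, 0 => //=; rewrite normr0.
by move=> _ [x /= x1 <-]; rewrite (le_trans (uC x))// ler_piMr.
Qed.

Lemma le_opnorm V W (u : {linear V -> W}) x : continuous u ->
  `|u x| <= opnorm u * `|x|.
Proof.
move=> /continuous_bounded[C C0 uC].
have [->|x0] := eqVneq x 0; first by rewrite linear0 !normr0 mulr0.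
rewrite -ler_pdivrMr ?normr_gt0//; apply: ub_le_sup.
  by exists C => _ [y /= y1 <-]; rewrite (le_trans (uC y))// ler_piMr// ltW.
exists (`|x|^-1 *: x) => /=.
  by rewrite normrZ normfV normr_id mulVf// normr_eq0.
by rewrite linearZ normrZ normfV normr_id mulrC.
Qed.

Lemma opnorm_ge0 V W (u : {linear V -> W}) : continuous u -> 0 <= opnorm u.
Proof.
move=> /continuous_bounded[C C0 uC]; apply: (@le_trans _ _ `|u 0|) => //.
apply: ub_le_sup; last by exists 0 => //=; rewrite normr0.
by exists C => _ [y /= y1 <-]; rewrite (le_trans (uC y))// ler_piMr// ltW.
Qed.

Lemma distortion_ge0 V W (u : isomorphism V W) : 0 <= distortion u.
Proof.
by rewrite mulr_ge0// opnorm_ge0//; case: u.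
Qed.

End OperatorNorm.

(** * Embeddings with controlled constants *)

Section Embeddings.
Variable R : realType.
Implicit Types V W U : normedModType R.

(** An isomorphism onto a subspace with distortion at most [c], scaled so that the lower constant is
    1. Constants then simply multiply under composition. *)
Definition emb (c : R) V W :=
  exists f : {linear V -> W}, forall x, `|x| <= `|f x| <= c * `|x|.

Lemma emb_trans c d U V W : 0 <= d -> emb c U V -> emb d V W -> emb (c * d) U W.
Proof.
move=> d0 [f fP] [g gP]; exists (g \o f : {linear _ -> _}) => x /=.
have /andP[fx1 fx2] := fP x; have /andP[gx1 gx2] := gP (f x).
rewrite (le_trans fx1 gx1)/= (le_trans gx2)// [c * d]mulrC -mulrA.
exact: ler_wpM2l.
Qed.

Lemma emb_le c d V W : c <= d -> emb c V W -> emb d V W.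
Proof.
move=> cd [f fP]; exists f => x; have /andP[-> /le_trans->//] := fP x.
exact: ler_wpM2r.
Qed.

Lemma emb_isometric V W : isometric V W -> emb 1 V W.
Proof. by move=> [f [_ fN]]; exists f => x; rewrite fN mul1r lexx. Qed.

Lemma isometric_sym V W : isometric V W -> isometric W V.
Proof.
move=> [f [/bijective_linear_inv[g [fK gK]] fN]].
by exists g; split; [exists f|move=> x; rewrite -fN gK].
Qed.

Lemma subsp_val_linear V (A : submodClosed V) : linear (@subsp_val R V A).
Proof. exact: (linearP (val : subsp A -> V)). Qed.

Lemma emb_subsp V (A : submodClosed V) : emb 1 (subsp A) V.
Proof. by exists (val : subsp A -> V) => x; rewrite mul1r lexx. Qed.

Lemma emb_inj c V W (f : {linear V -> W}) :
  (forall x, `|x| <= `|f x| <= c * `|x|) -> injective f.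
Proof.
move=> fP x y fxy; apply/eqP; rewrite -subr_eq0 -normr_le0.
by have /andP[/le_trans->//] := fP (x - y); rewrite linearB fxy subrr normr0.
Qed.

Lemma linear_range V W (f : {linear V -> W}) :
  exists (B : submodClosed W) (g : {linear V -> subsp B}),
    (forall y, exists x, g x = y) /\ forall x, subsp_val (g x) = f x.
Proof.
have [|a _ _ [x <-] [y <-]|B BP] := @submod_of R W (fun y => exists x, f x = y).
- by exists 0; rewrite linear0.
- by exists (a *: x + y); rewrite linearP.
have [x|a x x' y y' fy fy'|y|g gP] :=
    @rel_linear R V (subsp B) (fun x y => subsp_val y = f x).
- have fxB : f x \in B by apply/BP; exists x.
  by exists (Subsp fxB).
- by rewrite subsp_val_linear fy fy' linearP.
- by rewrite linear0 => y0; apply: val_inj; rewrite raddf0.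
exists B, g; split=> // y; have /BP[x fx] := subsp_valP y.
by exists x; apply: val_inj; rewrite /= gP.
Qed.

Lemma linear_range_inj V W (f : {linear V -> W}) : injective f ->
  exists (B : submodClosed W) (g : {linear V -> subsp B}),
    bijective g /\ forall x, subsp_val (g x) = f x.
Proof.
move=> finj; have [B [g [gs gP]]] := linear_range f.
exists B, g; split=> //; apply: inj_surj_bijective => // x y gxy.
by apply: finj; rewrite -!gP gxy.
Qed.

Lemma isomorphism_of_emb c V W (f : {linear V -> W}) : bijective f ->
  0 <= c -> (forall x, `|x| <= `|f x| <= c * `|x|) ->
  exists u : isomorphism V W, distortion u <= c.
Proof.
move=> /bijective_linear_inv[g [fK gK]] c0 fP.
have fc x : `|f x| <= c * `|x| by have /andP[] := fP x.
have g1 y : `|g y| <= 1 * `|y| by have /andP[+ _] := fP (g y); rewrite gK mul1r.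
exists (Isomorphism fK gK (bounded_continuous fc) (bounded_continuous g1)).
rewrite /distortion/= -[c]mulr1 ler_pM ?opnorm_le//.
  exact: opnorm_ge0 (bounded_continuous fc).
exact: opnorm_ge0 (bounded_continuous g1).
Qed.

(** Scaling the map by the norm of its inverse makes the lower constant 1. *)
Lemma emb_isomorphism V W (u : isomorphism V W) : emb (distortion u) V W.
Proof.
case: u => f g fK gK fc gc; rewrite /distortion/=.
(* [opnorm g = 0] only if [V] is the zero space *)
have [g0|g0] := eqVneq (opnorm g) 0.
  exists f => x; have := le_opnorm (f x) gc.
  rewrite fK g0 mul0r normr_le0 => /eqP->.
  by rewrite linear0 !normr0 mulr0 lexx.
exists (opnorm g \*: f : {linear _ -> _}) => x /=.
rewrite normrZ ger0_norm ?opnorm_ge0// -{1}(fK x) le_opnorm//=.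
rewrite [opnorm f * _]mulrC -mulrA ler_wpM2l ?opnorm_ge0//.
exact: le_opnorm.
Qed.

(** Ensures that the infimum in [bmdist] is over a nonempty set, so that a strict upper bound on it
    produces an actual isomorphism. *)
Lemma finite_dim_isomorphism V W n : has_dim V n -> has_dim W n ->
  inhabited (isomorphism V W).
Proof.
move=> hV hW; have [f [f' [fK f'K]]] := has_dimP hV.
have [g [g' [gK g'K]]] := has_dimP hW.
have hK : cancel (g' \o f : {linear V -> W}) (f' \o g : {linear W -> V}).
  by move=> x /=; rewrite g'K fK.
have h'K : cancel (f' \o g : {linear W -> V}) (g' \o f : {linear V -> W}).
  by move=> x /=; rewrite f'K gK.
have Vf : finite_dim V by exists n.
have Wf : finite_dim W by exists n.
have [C _ /bounded_continuous hc] := finite_dim_linear_bounded (g' \o f) Vf.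
have [D _ /bounded_continuous h'c] := finite_dim_linear_bounded (f' \o g) Wf.
exact: inhabits (Isomorphism hK h'K hc h'c).
Qed.

End Embeddings.

(** * Finite representability and Minkowski's base in terms of embeddings *)

Section FiniteRepresentability.
Variable R : realType.
Implicit Types (V : normedModType R) (X Y : completeNormedModType R).

(** The range of the embedding is a finite dimensional subspace of [X], which can be moved to [Y] at
    the cost of the factor [d]. *)
Lemma fin_rep_emb X Y V c d : fin_rep X Y -> finite_dim V -> 1 < d ->
  emb c V X -> emb (c * d) V Y.
Proof.
move=> XY Vf d1 [f fP]; have [A [g [gb gP]]] := linear_range_inj (emb_inj fP).
have Af : finite_dim (subsp A).
  by have [n Vn] := Vf; exists n; exact: has_dim_bij gb Vn.
have VA : emb c V (subsp A).
  by exists g => x; rewrite -[ `|g x|]/`|subsp_val (g x)| gP.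
have [|B [u ud]] := XY (d - 1) _ A Af; first by rewrite subr_gt0.
have d0 : 0 <= d by rewrite ltW// (lt_trans ltr01).
apply: emb_trans d0 VA _; rewrite -[d]mulr1; apply: emb_trans => //.
  by apply: emb_le (emb_isomorphism u); rewrite (le_trans ud)// subrKC.
exact: emb_subsp.
Qed.

Lemma emb_fin_rep X Y :
  (forall c : R, 1 < c -> forall A : submodClosed X, finite_dim (subsp A) ->
     emb c (subsp A) Y) -> fin_rep X Y.
Proof.
move=> XY e e0 A Af.
have [|f fP] := XY (1 + e) _ A Af; first by rewrite ltrDl.
have [B [g [gb gP]]] := linear_range_inj (emb_inj fP).
have [||u ud] := @isomorphism_of_emb R (1 + e) _ _ g gb; last by exists B, u.
  by rewrite addr_ge0// ltW.
by move=> x; rewrite -[ `|g x|]/`|subsp_val (g x)| gP.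
Qed.

Lemma fin_rep_refl X : fin_rep X X.
Proof.
by apply: emb_fin_rep => c c1 A _; apply: emb_le (ltW c1) (emb_subsp A).
Qed.

Lemma mk_of V : finite_dim V -> exists E : minkowski R, isometric E V.
Proof.
move=> Vf; have [n Vn] := Vf.
pose V' := HB.pack_for (completeNormedModType R) (NormedModule.sort V)
  (Uniform_isComplete.Build V (finite_dim_complete Vf)).
exists (@Minkowski R V' n Vn).
by exists idfun; split=> //; exists idfun.
Qed.

(** If a subspace of [X] is within [ln c] of [E], an isomorphism onto it embeds [E] with constant
    [c]. Conversely, the ranges of embeddings with constants near 1 are subspaces of [X] that
    approximate [E]. *)
Lemma mk_base_emb X (E : minkowski R) :
  mk_base X E <-> forall c, 1 < c -> emb c E X.
Proof.
split=> [EX c c1|EX e e0].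
  have [G [[A GA] [GE]]] := EX (ln c) (ln_gt0 c1).
  have c0 : 0 < c by exact: lt_trans c1.
  set b := bmdist E G => bc.
  (* [b] may be [0], where [ln] is no longer the inverse of [expR] *)
  have {}bc : b < c.
    by have [/le_lt_trans->//|b0] := leP b 0; rewrite -ltr_ln// posrE.
  have [u0] : inhabited (isomorphism E G).
    apply: (@finite_dim_isomorphism R E G (mk_dim E)); first exact: mk_dimP.
    by rewrite -GE; exact: mk_dimP.
  have [_ [u ->] uc] := inf_lt (ex_intro _ _ (ex_intro _ u0 erefl)) bc.
  rewrite -[c]mulr1; apply: emb_trans (emb_le (ltW uc) (emb_isomorphism u)) _ => //.
  by rewrite -[1]mulr1; apply: emb_trans (emb_isometric GA) (emb_subsp A).
(* Half of [e] is used because the ball is open, while the distortion is only bounded by a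
   non-strict inequality. *)
have c1 : 1 < expR (e / 2) by rewrite expR_gt1 divr_gt0.
have [f fP] := EX _ c1; have [B [g [gb gP]]] := linear_range_inj (emb_inj fP).
have dE : has_dim (subsp B) (mk_dim E) by exact: has_dim_bij gb (mk_dimP E).
have Bf : finite_dim (subsp B) by exists (mk_dim E).
pose B' := HB.pack_for (completeNormedModType R) (subsp B)
  (Uniform_isComplete.Build (subsp B) (finite_dim_complete Bf)).
exists (@Minkowski R B' (mk_dim E) dE); split.
  by exists B, idfun; split=> //; exists idfun.
split=> //; have [||u uc] := @isomorphism_of_emb R (expR (e / 2)) E (subsp B) g gb.
- exact: expR_ge0.
- by move=> x; rewrite -[ `|g x|]/`|subsp_val (g x)| gP.
have db : bmdist E (subsp B) <= expR (e / 2).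
  apply: le_trans uc; apply: ge_inf; last by exists u.
  by exists 0 => _ [v ->]; exact: distortion_ge0.
apply: (@le_lt_trans _ _ (e / 2)); last by lra.
(* [ln] is 0 at nonpositive arguments, and its monotonicity applies only to positive ones. *)
have [d0|d0] := leP (bmdist E (subsp B)) 0.
  by rewrite ln0// divr_ge0// ltW.
by rewrite -[leRHS]expRK ler_ln// posrE expR_gt0.
Qed.

End FiniteRepresentability.

(** * Finite spans, finite nets and closed subspaces *)

Section Spans.
Variable R : realType.

Lemma rV_comb_linear n (V : lmodType R) (y : 'I_n -> V) :
  exists h : {linear 'rV[R]_n -> V}, forall v, h v = \sum_i v 0 i *: y i.
Proof.
pose h (v : 'rV[R]_n) := \sum_i v 0 i *: y i.
have hl : linear h.
  move=> a u v; rewrite /h scaler_sumr -big_split; apply: eq_bigr => i _.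
  by rewrite !mxE scalerDl scalerA.
by exists (HB.pack_for {linear 'rV[R]_n -> V} h
  (GRing.isLinear.Build R _ V *:%R h hl)).
Qed.

(** [G] is the range of the map sending coefficients to linear combinations of [s]; the vectors may
    be dependent, since a linear image of a finite dimensional space is finite dimensional. *)
Lemma span_finite_dim (V : normedModType R) (s : seq V) :
  exists G : submodClosed V, finite_dim (subsp G) /\ {subset s <= G}.
Proof.
have [h hP] := rV_comb_linear (fun i : 'I_(size s) => s`_i).
have [G [g [gs gP]]] := linear_range h.
exists G; split.
  by apply: finite_dim_surj gs _; exists (size s), idfun; exists idfun.
move=> y /(nthP 0)[i si <-].
suff -> : s`_i = subsp_val (g (delta_mx 0 (Ordinal si))) by exact: subsp_valP.
rewrite gP hP (bigD1 (Ordinal si))//= !mxE !eqxx scale1r big1 ?addr0// => j ji.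
by rewrite !mxE (negPf ji) scale0r.
Qed.

(** A finite subcover of the compact ball by open balls of radius [d]. The centres may lie outside
    the ball. *)
Lemma rV_ball_net n (D d : R) : 0 < d ->
  exists T : seq 'rV[R]_n, forall v, `|v| <= D -> exists2 t, t \in T & `|v - t| < d.
Proof.
move=> d0; pose B : set 'rV[R]_n := [set v | `|v| <= D].
have : compact B.
  apply: bounded_closed_compact.
    by exists D; split=> [|M DM v vD]; [exact: num_real|exact: le_trans vD (ltW DM)].
  have -> : B = (fun v => `|v|) @^-1` [set x | x <= D] by [].
  by apply: closed_comp => [v _|]; [exact: norm_continuous|exact: closed_le].
rewrite compact_cover => /(_ _ setT (fun t => ball t d)).
case=> [t _|v _|T _ BT]; first exact: ball_open.
  by exists v => //; exact: ballxx.
exists (enum_fset T) => v /BT[t tT]; rewrite -ball_normE /ball_/= distrC.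
by exists t.
Qed.

(** In coordinates [A] is the kernel of multiplication by a cokernel matrix, which is continuous. *)
Lemma finite_dim_closed (V : normedModType R) (A : submodClosed V) :
  finite_dim V -> closed [set` A].
Proof.
move=> Vf; have [n /has_dimP[f [g [fK gK]]]] := Vf.
have [||M MP] := @submod_rowspace R n (fun v => g v \in A).
- by rewrite linear0 rpred0.
- by move=> a x y xA yA; rewrite linearP rpredD// rpredZ.
pose h := mulmxr (cokermx M) \o f : {linear V -> 'rV[R]_n}.
have [C _ /bounded_continuous hc] := finite_dim_linear_bounded h Vf.
have -> : [set` A] = h @^-1` [set 0].
  apply/seteqP; split=> x /=.
    by rewrite -{1}(fK x) => /MP; rewrite submxE => /eqP.
  by move=> hx; rewrite -(fK x); apply/MP; rewrite submxE; apply/eqP.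
apply: closed_comp => [x _|]; first exact: hc.
exact: (accessible_closed_set1 (hausdorff_accessible (@norm_hausdorff R 'rV[R]_n))).
Qed.

End Spans.

(** * Stability of HQ under quotients, and almost isometric lifting *)

Section Quotients.
Variable R : realType.
Implicit Types V W : normedModType R.

Lemma quot_pi_norm_le V (F : submodClosed V) (cF : closed [set` F]) x :
  `|quot_pi cF x| <= `|x|.
Proof. exact: quot_norm_le. Qed.

Lemma quot_pi_lift V (F : submodClosed V) (cF : closed [set` F])
    (q : quotsp cF) (e : R) :
  `|q| < e -> exists2 x, quot_pi cF x = q & `|x| < e.
Proof. exact: quot_norm_lt. Qed.

Lemma quotsp_finite_dim V (F : submodClosed V) (cF : closed [set` F]) :
  finite_dim V -> finite_dim (quotsp cF).
Proof.
apply: (@finite_dim_surj R V (quotsp cF) (quot_pi cF)).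
exact: quot_pi_surj.
Qed.

(** The upper estimate at 0 already forces [r] to be single-valued. *)
Lemma emb_rel (c : R) V W (r : V -> W -> Prop) :
  (forall x, exists y, r x y) ->
  (forall a x x' y y', r x y -> r x' y' -> r (a *: x + x') (a *: y + y')) ->
  (forall x y, r x y -> `|x| <= `|y| <= c * `|x|) ->
  emb c V W.
Proof.
move=> rt rD rN; have [//|//|y /rN/andP[_]|f rf] := @rel_linear R V W r.
  by rewrite normr0 mulr0 normr_le0 => /eqP.
by exists f => x; exact: rN.
Qed.

Lemma isometric_range V W : emb 1 V W ->
  exists B : submodClosed W, isometric V (subsp B).
Proof.
move=> [f fP]; have [B [g [gb gP]]] := linear_range_inj (emb_inj fP).
exists B, g; split=> // x; rewrite -[ `|g x|]/`|subsp_val (g x)| gP.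
by apply/eqP; rewrite eq_le andbC; have := fP x; rewrite mul1r.
Qed.

(** [V] embeds isometrically by [k] into a quotient [D/F] with [D] in [K]. Let [N'] be the preimage
    of [k(N)] in [D]. Then [D/N'] is the quotient of [D/F] by [k(N)], and it contains [V/N]
    isometrically. *)
Lemma mk_HQ_quotient (K : mk_set R) (E E' : minkowski R) V (N : submodClosed V)
    (cN : closed [set` N]) :
  mk_HQ K E -> emb 1 V E -> isometric E' (quotsp cN) -> mk_HQ K E'.
Proof.
move=> [G [[D [KD [F [cF GF]]]] [A EA]]] VE E'N.
have [k kP] : emb (1 * (1 * (1 * 1))) V (quotsp cF).
  apply: emb_trans VE _; first by rewrite !mulr1.
  apply: emb_trans (emb_isometric EA) _; first by rewrite !mulr1.
  by apply: emb_trans (emb_subsp A) (emb_isometric GF).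
have {kP} kN x : `|k x| = `|x|.
  by apply/eqP; rewrite eq_le andbC; have := kP x; rewrite !mul1r.
have [||N' N'P] := @submod_of R D (fun d => exists2 x, x \in N & k x = quot_pi cF d).
- by exists 0; rewrite ?rpred0// !linear0.
- move=> a x y [u uN ku] [v vN kv]; exists (a *: u + v).
    by rewrite rpredD// rpredZ.
  by rewrite !linearP ku kv.
have Df : finite_dim D by exists (mk_dim D); exact: mk_dimP.
have cN' := finite_dim_closed (A := N') Df.
have [G' G'N] := mk_of (quotsp_finite_dim cN' Df).
exists G'; split; first by exists D; split=> //; exists N', cN'.
apply: isometric_range; rewrite -[1]mulr1.
apply: emb_trans (emb_isometric E'N) _ => //; rewrite -[1]mulr1.
apply: emb_trans _ (emb_isometric (isometric_sym G'N)) => //.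
apply: (@emb_rel _ _ _ (fun q q' => exists x d,
  [/\ quot_pi cN x = q, k x = quot_pi cF d & quot_pi cN' d = q'])).
- move=> q; have [x xq] := quot_pi_surj q; have [d dx] := quot_pi_surj (k x).
  by exists (quot_pi cN' d), x, d.
- move=> a _ _ _ _ [x [d [<- xd <-]]] [x' [d' [<- xd' <-]]].
  by exists (a *: x + x'), (a *: d + d'); rewrite !linearP xd xd'.
move=> _ _ [x [d [<- xd <-]]]; rewrite mul1r; apply/andP; split.
  (* A short representative [d0] of the class of [d] modulo [N'] lies over [k (x + n)] with [n] in
     [N], so [x + n] is an equally short representative of the class of [x]. *)
  rewrite leNgt; apply/negP => /quot_pi_lift[d0 /quot_piP/N'P[n nN kn] /=].
  apply/negP; rewrite -leNgt -(_ : quot_pi cN (x + n) = quot_pi cN x).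
    rewrite (le_trans (quot_pi_norm_le _ _))// -kN linearD xd kn -linearD.
    by rewrite addrC subrK quot_pi_norm_le.
  by apply/quot_piP; rewrite addrAC subrr add0r.
(* Conversely, a short representative [x0] of the class of [x] has a short [k x0], which lifts to a
   short [d0] in [D] congruent to [d] modulo [N']. *)
rewrite leNgt; apply/negP => /quot_pi_lift[x0 /quot_piP xN].
rewrite -kN => /quot_pi_lift[d0 d0x /=].
apply/negP; rewrite -leNgt -(_ : quot_pi cN' d0 = quot_pi cN' d).
  exact: quot_pi_norm_le.
by apply/quot_piP/N'P; exists (x0 - x) => //; rewrite linearB xd -d0x -linearB.
Qed.

(** [G] is spanned by nearly norm-minimal lifts [z t] of net points and by lifts [e i] of a basis.
    The former control the norm; the latter give a bounded linear lift [s] that corrects the net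
    error exactly. *)
Lemma finite_dim_lift V W (F : submodClosed V) (cF : closed [set` F])
    (k : {linear W -> quotsp cF}) (c : R) :
  finite_dim W -> (forall x, `|k x| <= `|x|) -> 1 < c ->
  exists G : submodClosed V, finite_dim (subsp G) /\
    forall x, exists2 y, y \in G & quot_pi cF y = k x /\ `|y| <= c * `|x|.
Proof.
move=> Wf kN c1; have [n /has_dimP[f [g [fK gK]]]] := Wf.
have [D D0 fD] := finite_dim_linear_bounded f Wf.
have [C C0 gC] := rV_linear_bounded g.
have /choice[e eP] : forall i : 'I_n, exists y, quot_pi cF y = k (g (delta_mx 0 i)).
  by move=> i; exact: quot_pi_surj.
have [s sP] := rV_comb_linear e.
have spi v : quot_pi cF (s v) = k (g v).
  rewrite sP [in RHS](row_sum_delta v) !linear_sum; apply: eq_bigr => i _.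
  by rewrite !linearZ/= eP.
have [M M0 sM] := rV_linear_bounded s.
(* The excess over 1 in the final norm estimate is at most [C * d] from [g t], [d] from the lift
   [z t] and [M * d] from the correction, in total [c - 1]. *)
pose d := (c - 1) / (C + 1 + M).
have CM0 : 0 < C + 1 + M by rewrite !addr_gt0.
have d0 : 0 < d by rewrite divr_gt0// subr_gt0.
have [T TP] := @rV_ball_net R n D d d0.
have /choice[z zP] : forall t : 'rV[R]_n,
    exists y, quot_pi cF y = k (g t) /\ `|y| < `|g t| + d.
  move=> t; have : `|k (g t)| < `|g t| + d by rewrite ltr_pwDr.
  by move=> /quot_pi_lift[y ? ?]; exists y.
have [G [Gf GP]] := span_finite_dim (map z T ++ map e (enum 'I_n)).
exists G; split=> // x; have [->|x0] := eqVneq x 0.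
  by exists 0; rewrite ?rpred0// !linear0 !normr0 mulr0.
pose u := `|x|^-1 *: x.
have u1 : `|u| = 1 by rewrite normrZ normfV normr_id mulVf// normr_eq0.
have xu : x = `|x| *: u by rewrite scalerA mulfV ?scale1r// normr_eq0.
have [|t tT ut] := TP (f u); first by rewrite (le_trans (fD u))// u1 mulr1.
have [zt zN] := zP t.
exists (`|x| *: (z t + s (f u - t))).
  rewrite rpredZ// rpredD//.
    by apply: GP; rewrite mem_cat map_f.
  rewrite sP rpred_sum// => i _; rewrite rpredZ//; apply: GP.
  by rewrite mem_cat map_f ?mem_enum// orbT.
split.
  by rewrite linearZ linearD/= zt spi -linearD -linearD subrKC fK -linearZ -xu.
rewrite normrZ normr_id mulrC ler_wpM2r//.
have gt : `|g t| <= 1 + C * d.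
  rewrite -(subrKC (g (f u)) (g t)) (le_trans (ler_normD _ _))// fK u1 lerD2l.
  rewrite -{1}(fK u) -linearB (le_trans (gC _))// distrC.
  by rewrite ler_pM2l// ltW.
have su : `|s (f u - t)| <= M * d by rewrite (le_trans (sM _))// ler_pM2l// ltW.
have dE : (C + 1 + M) * d = c - 1 by rewrite /d mulrC divfK// gt_eqF.
rewrite (le_trans (ler_normD _ _))//; lra.
Qed.

End Quotients.

(** * Quotients of spaces finitely representable in a closed class *)

Theorem theorem9 (R : realType) (X : completeNormedModType R)
    (hX : starstar_closed (fin_class X))
    (Y : completeNormedModType R) (hYX : fin_rep Y X)
    (F : submodClosed Y) (cF : closed [set` F]) :
  fin_rep (quotsp cF) X.
Proof.
have [W [V [XV MV]]] := hX.
have [VX {}XV] : fin_class V X by rewrite -XV; split; exact: fin_rep_refl.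
apply: emb_fin_rep => c c1 A Af.
(* A cube root of [c]: one factor for embedding [A] into [G/N], one for [G/N] into [V], one for
   passing from [V] to [X]. *)
pose d := expR (ln c / 3).
have d1 : 1 < d by rewrite expR_gt1 divr_gt0// ln_gt0.
have d0 : 0 <= d by exact: expR_ge0.
have -> : c = d * d * d.
  rewrite /d -!expRD -[LHS]lnK; last by rewrite posrE (lt_trans ltr01).
  by congr expR; lra.
apply: (fin_rep_emb VX Af d1).
have [G [Gf GP]] := @finite_dim_lift R Y (subsp A) F cF (val : subsp A -> quotsp cF)
  d Af (fun x => lexx _) d1.
(* [N] is the intersection of [G] and [F], seen inside [G]. *)
have [|a x y xN yN|N NP] := @submod_of R (subsp G) (fun y => subsp_val y \in F).
- exact: rpred0.
- by rewrite subsp_val_linear rpredD// rpredZ.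
have cN := finite_dim_closed (A := N) Gf.
have quotNF y y' : quot_pi cN y = quot_pi cN y' <->
    quot_pi cF (subsp_val y) = quot_pi cF (subsp_val y').
  rewrite !quot_piP NP.
  by have -> : subsp_val (y - y') = subsp_val y - subsp_val y'
    by exact: (raddfB (val : subsp G -> Y)).
(* A point of [A] goes to the class of any of its lifts in [G]. Passing from [F] to [N] leaves fewer
   representatives, so norms cannot drop; the lifts of norm at most [d] times that of the point give
   the upper bound. *)
have AGN : emb d (subsp A) (quotsp cN).
  apply: (@emb_rel R d _ _ (fun a q => exists2 y : subsp G,
    quot_pi cF (subsp_val y) = subsp_val a & quot_pi cN y = q)).
  - move=> a; have [y yG [ya _]] := GP a.
    by exists (quot_pi cN (Subsp yG)), (Subsp yG).
  - move=> b a a' _ _ [y ya <-] [y' ya' <-]; exists (b *: y + y').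
      by rewrite !subsp_val_linear linearP/= ya ya'.
    by rewrite linearP.
  move=> a _ [y ya <-]; apply/andP; split.
    rewrite leNgt; apply/negP => /quot_pi_lift[y0 /quotNF y0y].
    apply/negP; rewrite -leNgt -[ `|a|]/`|subsp_val a| -ya -y0y.
    exact: quot_pi_norm_le.
  have [y0 y0G [y0a y0N]] := GP a.
  apply: le_trans y0N; rewrite (_ : quot_pi cN y = quot_pi cN (Subsp y0G)).
    exact: quot_pi_norm_le.
  by apply/quotNF; rewrite ya.
apply: emb_trans AGN _ => //.
have [E EG] := mk_of Gf.
have [E' E'N] := mk_of (quotsp_finite_dim cN Gf).
have /mk_base_emb E'V : mk_base V E'.
  rewrite MV; apply: mk_HQ_quotient _ (emb_isometric (isometric_sym EG)) E'N.
  (* [G] embeds into [Y], then into [X], then into [V]; each of the last two moves costs a factor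
     [e], a square root of [b]. *)
  rewrite -MV; apply/mk_base_emb => b b1.
  pose e := expR (ln b / 2).
  have e1 : 1 < e by rewrite expR_gt1 divr_gt0// ln_gt0.
  have -> : b = 1 * (1 * e * e).
    rewrite !mul1r /e -expRD -splitr lnK// posrE; exact: lt_trans b1.
  apply: emb_trans (emb_isometric EG) _.
    by rewrite !mulr_ge0// expR_ge0.
  exact: fin_rep_emb XV Gf e1 (fin_rep_emb hYX Gf e1 (emb_subsp G)).
rewrite -[d]mul1r.
exact: emb_trans d0 (emb_isometric (isometric_sym E'N)) (E'V d d1).
Qed.
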